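(* For every $P \ge 1$ and every $\alpha$ (with $0\le \alpha \le 1$), there is a randomized $P$-party simultaneous message protocol for maximum bipartite matching on $n$-vertex graphs with expected approximation factor $n^{\alpha}$ in which all messages have size $\tilde{\mathrm{O}}(n^{2-2\alpha})$.
   Context: Simultaneous message (SIM) model: a bipartite graph $G=(A,B,E)$ on $n$ vertices is given, and $G_1,\dots,G_P$ are edge-disjoint subgraphs of $G$ whose union is $G$. For each $p\in[P]$, party $p$ receives only $G_p$ and sends a single message to a referee; parties cannot communicate with each other but share public random coins. Upon receiving all messages, the referee outputs a matching $N$ of $G$. The expected approximation factor is $\mathbb{E}[|M^*|/|N|]$ with $M^*$ a maximum matching of $G$. $\tilde{\mathrm{O}}(\cdot)$ is $\mathrm{O}(\cdot)$ ignoring polylogarithmic factors in $n$. *)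

(* Defs.v *)
From HB Require Import structures.
From mathcomp Require Import all_boot all_order all_algebra.
From mathcomp Require Import reals constructive_ereal ereal exp.

Set Implicit Arguments.
Unset Strict Implicit.
Unset Printing Implicit Defensive.

Import Order.TTheory GRing.Theory Num.Theory.

(* A bipartite graph with vertices among V.  An edge joining a in A to b in B
   is the ordered pair (a, b). *)
Record bigraph (V : finType) := Bigraph {
  sideA : {set V};
  sideB : {set V};
  edges : {set V * V};
  _ : [disjoint sideA & sideB];
  _ : forall e, e \in edges -> (e.1 \in sideA) && (e.2 \in sideB)
}.

Definition vertices (V : finType) (G : bigraph V) : {set V} :=
  sideA G :|: sideB G.

Definition subgraph (V : finType) (H G : bigraph V) : Prop :=
  [/\ sideA H \subset sideA G, sideB H \subset sideB G &
      edges H \subset edges G].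

(* The subgraphs need not be spanning: a party may see only part of A and B. *)
Definition edge_disjoint_union (V : finType) (P : nat)
    (G : bigraph V) (Gs : 'I_P -> bigraph V) : Prop :=
  [/\ forall p, subgraph (Gs p) G,
      forall p q, p != q -> [disjoint edges (Gs p) & edges (Gs q)],
      \bigcup_(p < P) sideA (Gs p) = sideA G,
      \bigcup_(p < P) sideB (Gs p) = sideB G &
      \bigcup_(p < P) edges (Gs p) = edges G].

(* The sides are disjoint, so two edges share an endpoint exactly when their
   first components or their second components agree. *)
Definition is_matching (V : finType) (G : bigraph V) (N : {set V * V}) : bool :=
  (N \subset edges G) &&
  [forall e in N, forall f in N, (e.1 == f.1) || (e.2 == f.2) ==> (e == f)].

Definition matching_number (V : finType) (G : bigraph V) : nat :=
  \max_(N : {set V * V} | is_matching G N) #|N|.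

(* The public coins are a string of ncoins independent fair bits, read by all
   parties; messages are bit strings. *)
Record sim_protocol (n P : nat) := SimProtocol {
  ncoins : nat;
  message : 'I_P -> bigraph 'I_n -> ncoins.-tuple bool -> seq bool;
  referee : {ffun 'I_P -> seq bool} -> {set 'I_n * 'I_n}
}.

Definition run (n P : nat) (prot : sim_protocol n P)
    (Gs : 'I_P -> bigraph 'I_n) (w : (ncoins prot).-tuple bool) :
    {set 'I_n * 'I_n} :=
  referee prot [ffun p => message p (Gs p) w].

Local Open Scope ring_scope.

(* |M*| / |N|, with value 1 if G has no edge, and +oo if N is empty although G
   has an edge. *)
Definition approx_factor (R : realType) (V : finType)
    (G : bigraph V) (N : {set V * V}) : \bar R :=
  if matching_number G == 0%N then 1%E
  else if #|N| == 0%N then +oo%E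
  else ((matching_number G)%:R / #|N|%:R)%:E.

Definition expected_factor (R : realType) (n P : nat)
    (prot : sim_protocol n P)
    (G : bigraph 'I_n) (Gs : 'I_P -> bigraph 'I_n) : \bar R :=
  (((2 ^+ ncoins prot)^-1)%:E *
   \sum_(w : (ncoins prot).-tuple bool) approx_factor R G (run Gs w))%E.

(* Main.v *)
Require Import Defs.
From HB Require Import structures.
From mathcomp Require Import all_boot all_order all_algebra.
From mathcomp Require Import reals constructive_ereal ereal exp.
From mathcomp Require Import ring lra.

Set Implicit Arguments.
Unset Strict Implicit.
Unset Printing Implicit Defensive.

Import Order.TTheory GRing.Theory Num.Theory.
Local Open Scope ring_scope.

(* Let [K] be a power of two with [6 K <= n ^ alpha < 12 K], or [K = 1] when
   [n ^ alpha < 6].  Cut the vertices into [B = n / K + 1] blocks of size at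
   most [K]; the coins select one vertex in each block.  Every party sends up to
   [B] of its edges at each selected vertex, and one arbitrary edge.  The referee
   returns a maximum matching [N] of the edges received.

   Fix a maximum matching [M] of size [m], and let [X] be the number of selected
   vertices that are left endpoints of [M].  Such a vertex either has its
   [M]-edge sent, or has [B] neighbours in the graph received; since at most [B]
   vertices are selected, the vertices of the second kind can be matched
   greedily, so [2 |N| >= X].  Also [|N| >= 1], hence
   [m / |N| <= 3 m / (1 + X)].  A second moment bound gives
   [E (1 / (1 + X)) <= 2 / (1 + m / K)], so the expected factor is at most
   [6 K].  For [K = 1] the whole graph is sent and the factor is 1. *)

(** * Edge sets as bit strings *)

Section FixedLengthCode.
Variables (U : finType) (l : nat) (c : U -> l.-tuple bool).
Hypotheses (l_gt0 : (0 < l)%N) (c_inj : injective c).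

Definition encode (E : {set U}) : seq bool :=
  flatten [seq tval (c u) | u <- enum E].

Lemma shape_code (s : seq U) :
  shape [seq tval (c u) | u <- s] = nseq (size s) l.
Proof. by elim: s => //= u s ->; rewrite size_tuple. Qed.

Lemma size_encode (E : {set U}) : size (encode E) = (#|E| * l)%N.
Proof. by rewrite size_flatten shape_code sumn_nseq mulnC -cardE. Qed.

(** As [l > 0], the length of the string determines [#|E|]; it can then be cut back into code words
    of length [l]. *)
Lemma encode_inj : injective encode.
Proof.
move=> E F eqEF.
have eqc : #|E| = #|F|.
  apply/eqP; rewrite -(eqn_pmul2r l_gt0) -!size_encode.
  by rewrite eqEF.
have: [seq tval (c u) | u <- enum E] = [seq tval (c u) | u <- enum F].
  rewrite -[LHS]flattenK -[RHS]flattenK !shape_code -!cardE eqc.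
  by congr reshape.
move/inj_map => eqe; apply/setP=> u; rewrite -mem_enum eqe ?mem_enum //.
by move=> x y /val_inj /c_inj.
Qed.

End FixedLengthCode.

(** * Maximum matchings and greedy matchings *)

Section Matchings.
Variable V : finType.
Implicit Types (E F M N : {set V * V}) (G : bigraph V).

Definition matching_set N : bool :=
  [forall e in N, forall f in N, (e.1 == f.1) || (e.2 == f.2) ==> (e == f)].

Lemma matching_setP N :
  reflect (forall e f, e \in N -> f \in N ->
             (e.1 == f.1) || (e.2 == f.2) -> e = f)
          (matching_set N).
Proof.
apply: (iffP forall_inP) => [h e f eN fN /= ef | h e eN].
  by apply/eqP; move: ef; apply/implyP; apply: (forall_inP (h e eN)).
by apply/forall_inP => f fN; apply/implyP => ef; apply/eqP/h.
Qed.

Lemma matching_sub M N : N \subset M -> matching_set M -> matching_set N.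
Proof.
move=> /subsetP sNM /matching_setP h; apply/matching_setP => e f eN fN.
by apply: h; apply: sNM.
Qed.

Lemma matching_set0 : matching_set set0.
Proof. by apply/matching_setP => e f; rewrite inE. Qed.

Lemma matching_set1 e : matching_set [set e].
Proof. by apply/matching_setP => f g; rewrite !inE => /eqP-> /eqP->. Qed.

Lemma matching_fst_inj N : matching_set N -> {in N &, injective fst}.
Proof.
by move=> /matching_setP h e f eN fN ef; apply: h => //; rewrite ef eqxx.
Qed.

Definition max_matching E : {set V * V} :=
  [arg max_(N > set0 | (N \subset E) && matching_set N) #|N|].

Lemma max_matching_sub E : max_matching E \subset E.
Proof.
by rewrite /max_matching; case: arg_maxnP => [|N /andP[]//];
  rewrite sub0set matching_set0.
Qed.

Lemma max_matching_set E : matching_set (max_matching E).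
Proof.
by rewrite /max_matching; case: arg_maxnP => [|N /andP[]//];
  rewrite sub0set matching_set0.
Qed.

Lemma max_matching_max E N :
  N \subset E -> matching_set N -> (#|N| <= #|max_matching E|)%N.
Proof.
move=> sNE mN; rewrite /max_matching.
case: arg_maxnP => [|M _ /(_ N)]; first by rewrite sub0set matching_set0.
by apply; rewrite sNE.
Qed.

Lemma max_matching_gt0 E : E != set0 -> (0 < #|max_matching E|)%N.
Proof.
case/set0Pn => e eE; rewrite -(cards1 e).
by apply: max_matching_max; rewrite ?sub1set ?matching_set1.
Qed.

Lemma matching_number_witness G :
  exists2 N, is_matching G N & #|N| = matching_number G.
Proof.
have h0 : is_matching G set0 by apply/andP; split;
  [rewrite sub0set | apply: matching_set0].
by case: (@eq_bigmax_cond _ (is_matching G) (fun N => #|N|)) => [|N hN hm];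
  [apply/card_gt0P; exists set0 | exists N].
Qed.

(* Greedy form of Hall's theorem. *)
Lemma greedy_matching E (H : {set V}) :
  (forall x, x \in H -> (#|H| <= #|[set y | (x, y) \in E]|)%N) ->
  exists N, [/\ N \subset E, matching_set N & fst @: N = H].
Proof.
move: {2}#|H| (erefl #|H|) => k; elim: k H => [|k IH] H cH deg.
  exists set0; split; rewrite ?sub0set ?matching_set0 //.
  by rewrite imset0; apply/esym/eqP; rewrite -cards_eq0 cH.
have [x xH] : exists x, x \in H by apply/card_gt0P; rewrite cH.
have cHx : #|H :\ x| = k by move: cH; rewrite (cardsD1 x) xH => -[].
have [|N [sNE mN imN]] := IH _ cHx.
  move=> y; rewrite !inE => /andP[_ /deg]; rewrite cHx cH; exact: leq_trans.
have cN : #|N| = k by rewrite -cHx -imN card_in_imset //;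
  apply: matching_fst_inj.
(* [N] occupies at most [k] right endpoints, while [x] has at least [k + 1] neighbours, so one of
   them is free. *)
have [y yE yN] : exists2 y, (x, y) \in E & y \notin snd @: N.
  have: [set y | (x, y) \in E] :\: (snd @: N) != set0.
    rewrite setD_eq0; apply: contraTN isT => /subset_leq_card.
    move=> /leq_trans /(_ (leq_imset_card _ _)) /(leq_trans (deg _ xH)).
    by rewrite cH cN ltnn.
  by case/set0Pn => y; rewrite !inE => /andP[? ?]; exists y.
have xN e : e \in N -> e.1 != x.
  by move=> eN; have := imset_f fst eN; rewrite imN !inE => /andP[].
have yN' e : e \in N -> e.2 != y.
  by move=> eN; apply: contraNneq yN => <-; apply: imset_f.
exists ((x, y) |: N); split.
- by rewrite subUset sub1set yE.
- apply/matching_setP => e f /setU1P[->|eN] /setU1P[->|fN] //=.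
  + by rewrite eq_sym (negPf (xN _ fN)) eq_sym (negPf (yN' _ fN)).
  + by rewrite (negPf (xN _ eN)) (negPf (yN' _ eN)).
  + by move/matching_setP: mN; apply.
- by rewrite imsetU1 imN setD1K.
Qed.

(* Each edge of [M] at a sampled vertex either is present in [E], or sits at a
   vertex of [E]-degree at least [D]: the former edges form a matching, and the
   vertices of the latter kind can be matched greedily. *)
Lemma max_matching_sampled E M (S : {set V}) (D : nat) :
  matching_set M -> (#|S| <= D)%N ->
  (forall e, e \in M -> e.1 \in S -> e \notin E ->
     (D <= #|[set y | (e.1, y) \in E]|)%N) ->
  (#|(fst @: M) :&: S| <= 2 * #|max_matching E|)%N.
Proof.
move=> mM cS deg.
pose H := [set x in fst @: (M :\: E) | x \in S].
have le1 : (#|M :&: E| <= #|max_matching E|)%N.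
  by apply: max_matching_max; rewrite ?subsetIr //; apply: matching_sub mM;
    rewrite subsetIl.
have le2 : (#|H| <= #|max_matching E|)%N.
  have cH : (#|H| <= D)%N.
    by apply: leq_trans cS; apply/subset_leq_card/subsetP => x;
      rewrite inE => /andP[].
  have [|N [sNE mN imN]] := @greedy_matching E H.
    move=> x; rewrite inE => /andP[/imsetP[e /setDP[eM eE] ->] xS].
    exact: leq_trans cH (deg _ eM xS eE).
  rewrite -imN; apply: leq_trans (leq_imset_card _ _) _.
  exact: max_matching_max.
rewrite mul2n -addnn; apply: leq_trans (leq_add le1 le2).
apply: (@leq_trans #|fst @: (M :&: E) :|: H|).
  apply/subset_leq_card/subsetP => x /setIP[/imsetP[e eM ->] eS].
  rewrite !inE; have [eE|eE] := boolP (e \in E).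
    by rewrite (imset_f fst) // inE eM.
  by apply/orP; right; rewrite eS andbT imset_f // !inE eM eE.
by rewrite cardsU; apply: leq_trans (leq_subr _ _) _;
  rewrite leq_add2r leq_imset_card.
Qed.

End Matchings.

(** * The edges sent by one party *)

Section SentEdges.
Variable V : finType.
Implicit Types (E : {set V * V}) (S : {set V}).

Definition first_neighbours (D : nat) E (x : V) : seq V :=
  take D (enum [set y | (x, y) \in E]).

(** The extra picked edge keeps the final matching nonempty whenever the graph has an edge, so the
    factor is never [+oo]. *)
Definition sent_edges (D : nat) S E : {set V * V} :=
  [set e in E | (e.1 \in S) && (e.2 \in first_neighbours D E e.1)]
  :|: (if [pick e in E] is Some e then [set e] else set0).

Lemma sent_edges_sub D S E : sent_edges D S E \subset E.
Proof.
apply/subsetP => e; rewrite !inE => /orP[/andP[]//|].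
by case: pickP => [f fE|_]; rewrite inE // => /eqP->.
Qed.

Lemma sent_edges_neq0 D S E : E != set0 -> sent_edges D S E != set0.
Proof.
case/set0Pn => e eE; apply/set0Pn; rewrite /sent_edges.
by case: pickP => [f _|/(_ e)]; [exists f; rewrite !inE eqxx orbT | rewrite eE].
Qed.

Lemma mem_first_neighbours D E x y : y \in first_neighbours D E x ->
  (x, y) \in E.
Proof. by move/mem_take; rewrite mem_enum inE. Qed.

Lemma card_sent_edges D S E : (#|sent_edges D S E| <= #|S| * D + 1)%N.
Proof.
rewrite /sent_edges; apply: leq_trans (leq_card_setU _ _) _; apply: leq_add;
  last first.
  by case: pickP => [e _|_]; rewrite ?cards1 ?cards0.
have sub : [set e in E | (e.1 \in S) && (e.2 \in first_neighbours D E e.1)]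
    \subset \bigcup_(x in S) [set (x, y) | y in first_neighbours D E x].
  apply/subsetP => -[x y]; rewrite !inE /= => /and3P[_ xS yx].
  by apply/bigcupP; exists x => //; apply: imset_f.
apply: leq_trans (subset_leq_card sub) _.
rewrite -sum_nat_const.
elim/big_rec2: _ => [|x k A _ leAk]; first by rewrite cards0.
apply: leq_trans (leq_card_setU _ _) _; apply: leq_add leAk.
apply: leq_trans (leq_imset_card _ _) _.
by apply: leq_trans (card_size _) _; rewrite size_take_min geq_minl.
Qed.

(** An edge at a vertex of [S] is omitted only if the neighbour list was truncated; the list then
    has length exactly [D], and all its edges are sent. *)
Lemma sent_edges_degree D S E e :
  e \in E -> e.1 \in S -> e \notin sent_edges D S E ->
  (D <= #|[set y | (e.1, y) \in sent_edges D S E]|)%N.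
Proof.
move=> eE eS; rewrite !inE negb_or eE eS /= => /andP[eN _].
have szD : (D <= size (enum [set y | (e.1, y) \in E]))%N.
  apply: contraNT eN; rewrite -ltnNge => /ltnW h.
  by rewrite /first_neighbours
    take_oversize // mem_enum inE -surjective_pairing.
have un : uniq (first_neighbours D E e.1) by rewrite take_uniq ?enum_uniq.
have szE : size (first_neighbours D E e.1) = D by rewrite size_takel.
rewrite -[X in (X <= _)%N]szE -(card_uniqP un);
  apply/subset_leq_card/subsetP => y yN.
by rewrite !inE /= eS yN (mem_first_neighbours yN).
Qed.

Lemma sent_edges_full D S E : S = [set: V] -> (#|V| <= D)%N ->
  sent_edges D S E = E.
Proof.
move=> -> cV; apply/eqP; rewrite eqEsubset sent_edges_sub;
  apply/subsetP => e eE.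
rewrite !inE eE /= /first_neighbours take_oversize
  ?mem_enum ?inE -?surjective_pairing ?eE //.
by rewrite -cardE; apply: leq_trans cV; apply: max_card.
Qed.

End SentEdges.

(** * Second moment bound for the mean of [1 / (1 + X)] *)

Section SecondMoment.
Variable R : realFieldType.

(* With [u = 1 + mu] and [d = x - mu], one has
   [1 / (1 + x) = (1 - d / u + d ^+ 2 / (u * (1 + x))) / u]. *)
Lemma inv1D_le_quadratic (mu x : R) : 0 <= mu -> 0 <= x ->
  (1 + x)^-1 <=
  (1 + mu)^-1 * (1 - (x - mu) / (1 + mu) + (x - mu) ^+ 2 / (1 + mu)).
Proof.
move=> mu0 x0; set u := 1 + mu.
have u0 : 0 < u by rewrite /u; lra.
have un0 : u != 0 by rewrite gt_eqF.
have xn0 : 1 + x != 0 by rewrite gt_eqF //; lra.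
have -> : (1 + x)^-1 =
    u^-1 * (1 - (x - mu) / u + (x - mu) ^+ 2 / u * (1 + x)^-1).
  by rewrite /u; field; rewrite xn0.
(* Only the factor [(1 + x)^-1 <= 1] of the nonnegative quadratic term is dropped. *)
rewrite ler_pM2l ?invr_gt0 // lerD2l ler_piMr //.
  by rewrite divr_ge0 ?sqr_ge0 // ltW.
by rewrite invf_le1; lra.
Qed.

(** On averaging the quadratic bound, the linear term vanishes and the variance is at most [mu];
    this leaves [(1 + mu / u) / u <= 2 / u] with [u = 1 + mu]. *)
Lemma sum_inv1D_le (T : finType) (X : T -> R) (mu : R) :
  0 <= mu -> (forall w, 0 <= X w) ->
  \sum_w X w = mu * #|T|%:R ->
  \sum_w X w ^+ 2 <= (mu ^+ 2 + mu) * #|T|%:R ->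
  \sum_w (1 + X w)^-1 <= 2 / (1 + mu) * #|T|%:R.
Proof.
move=> mu0 X0 EX EX2; set u := 1 + mu.
have u0 : 0 < u by rewrite /u; lra.
have un0 : u != 0 by rewrite gt_eqF.
apply: le_trans (ler_sum _ (fun w _ => inv1D_le_quadratic mu0 (X0 w))) _.
have -> : \sum_w u^-1 * (1 - (X w - mu) / u + (X w - mu) ^+ 2 / u) =
    \sum_w (u^-1 * (1 + mu / u + mu ^+ 2 / u)
            + u^-1 * (- u^-1 - 2 * mu / u) * X w + u^-1 / u * X w ^+ 2).
  by apply: eq_bigr => w _; field.
rewrite !big_split /= -!mulr_sumr EX sumr_const
  -[_ *+ #|_|]mulr_natr [u^-1 * (_ * _%:R)]mulrA.
set N := #|T|%:R in EX2 *.
have N0 : 0 <= N by rewrite ler0n.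
apply: (@le_trans _ _ (u^-1 * (1 + mu / u + mu ^+ 2 / u) * N
  + u^-1 * (- u^-1 - 2 * mu / u) * (mu * N) + u^-1 / u * ((mu ^+ 2 + mu) * N))).
  by rewrite lerD2l ler_pM2l // divr_gt0 // invr_gt0.
have -> : u^-1 * (1 + mu / u + mu ^+ 2 / u) * N
  + u^-1 * (- u^-1 - 2 * mu / u) * (mu * N) + u^-1 / u * ((mu ^+ 2 + mu) * N)
  = (1 + mu / u) / u * N by field.
apply: ler_wpM2r => //; rewrite ler_pM2r ?invr_gt0 //.
have : mu / u <= 1 by rewrite ler_pdivrMr // /u; lra.
lra.
Qed.

End SecondMoment.

(** * Hits of a uniform random choice of one position per block *)

Section RandomFunction.
Variables (R : realFieldType) (B K : nat).
Hypothesis K_gt0 : (0 < K)%N.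
Let T := {ffun 'I_B -> 'I_K}.
Let k : R := K%:R.

Let k_neq0 : k != 0. Proof. by rewrite pnatr_eq0 -lt0n. Qed.

Lemma card_random_function : #|T|%:R = k ^+ B.
Proof. by rewrite card_ffun !card_ord natrX. Qed.

(** This expresses the independence of the values of a uniform random function. *)
Lemma sum_function_prod (F : 'I_B -> 'I_K -> R) :
  \sum_(f : T) \prod_j F j (f j) = \prod_j \sum_i F j i.
Proof. by rewrite bigA_distr_bigA. Qed.

Lemma sum_delta (i : 'I_K) : \sum_i' (i' == i)%:R = 1 :> R.
Proof. by rewrite (bigD1 i) //= eqxx big1 ?addr0 // => j /negPf->. Qed.

Lemma sum_hit (j : 'I_B) (i : 'I_K) :
  \sum_(f : T) (f j == i)%:R = k^-1 * #|T|%:R.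
Proof.
(* The indicator becomes a product over all blocks; block [j] sums to 1 and every other block to
   [k]. *)
pose F j' i' : R := if j' == j then (i' == i)%:R else 1.
transitivity (\sum_(f : T) \prod_j F j (f j)).
  apply: eq_bigr => f _; rewrite (bigD1 j) //= big1 ?mulr1 /F ?eqxx //.
  by move=> j' /negPf->.
rewrite sum_function_prod (bigD1 j) //= {1}/F eqxx sum_delta mul1r.
rewrite (eq_bigr (fun=> k)); last first.
  by move=> j' /negPf h; rewrite /F h sumr_const card_ord.
have -> : #|T|%:R = k * \prod_(j' < B | j' != j) k.
  by rewrite card_random_function -[B in LHS]card_ord -prodr_const (bigD1 j).
by rewrite mulKf.
Qed.

Lemma sum_hit2 (j1 j2 : 'I_B) (i1 i2 : 'I_K) : j1 != j2 ->
  \sum_(f : T) (f j1 == i1)%:R * (f j2 == i2)%:R = k^-1 ^+ 2 * #|T|%:R.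
Proof.
move=> j12; have j21 : j2 != j1 by rewrite eq_sym.
pose F j' i' : R :=
  if j' == j1 then (i' == i1)%:R else if j' == j2 then (i' == i2)%:R else 1.
have F2 i : F j2 i = (i == i2)%:R by rewrite /F (negPf j21) eqxx.
transitivity (\sum_(f : T) \prod_j F j (f j)).
  apply: eq_bigr => f _; rewrite (bigD1 j1) //= (bigD1 j2 j21) //= F2.
  rewrite big1 ?mulr1 /F ?eqxx // => j' /andP[/negPf-> /negPf->] //.
rewrite sum_function_prod (bigD1 j1) //= {1}/F eqxx sum_delta mul1r.
rewrite (bigD1 j2 j21) //= (eq_bigr _ (fun i _ => F2 i)) sum_delta mul1r.
rewrite (eq_bigr (fun=> k)); last first.
  by move=> j' /andP[/negPf h1 /negPf h2]; rewrite /F h1 h2 sumr_const card_ord.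
have -> : #|T|%:R = k * (k * \prod_(j' < B | (j' != j1) && (j' != j2)) k).
  rewrite card_random_function -[B in LHS]card_ord -prodr_const (bigD1 j1) //=.
  by rewrite (bigD1 j2 j21).
by rewrite expr2 -mulrA !mulKf.
Qed.

(* The points of [S] are indexed by (block, position in block) pairs; [f] hits
   the point it selects in each block. *)
Lemma sum_inv_hits (V : finType) (S : {set V}) (blk : V -> 'I_B)
    (pos : V -> 'I_K) :
  {in S &, injective (fun x => (blk x, pos x))} ->
  \sum_(f : T) (1 + #|[set x in S | f (blk x) == pos x]|%:R)^-1
    <= 2 / (1 + #|S|%:R / k) * #|T|%:R.
Proof.
move=> inj; have k0 : 0 <= k by rewrite ler0n.
have hitE (f : T) : #|[set x in S | f (blk x) == pos x]|%:R =
    \sum_(x in S) (f (blk x) == pos x)%:R :> R.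
  rewrite -sum1_card natr_sum
    (eq_bigl (fun x => (x \in S) && (f (blk x) == pos x))).
    by rewrite big_mkcondr; apply: eq_bigr => x _; case: eqP.
  by move=> x; rewrite inE.
apply: sum_inv1D_le.
- by rewrite divr_ge0.
- by move=> f; rewrite ler0n.
- rewrite (eq_bigr _ (fun f _ => hitE f)) exchange_big /=.
  rewrite (eq_bigr (fun=> k^-1 * #|T|%:R)); last by move=> x _; rewrite sum_hit.
  by rewrite sumr_const -[LHS]mulr_natl mulrA.
under eq_bigr => f _ do rewrite hitE expr2 big_distrlr /=.
rewrite exchange_big /=.
under eq_bigr => x _ do rewrite exchange_big /=.
(* Each diagonal pair contributes [k^-1] and each other pair at most [k^-1 ^+ 2]. Allowing
   [k^-1 ^+ 2] on the diagonal as well makes the total exactly [mu ^+ 2 + mu] times [#|T|], for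
   [mu = #|S| / k]. *)
apply: (@le_trans _ _
  (\sum_(x in S) (\sum_(y in S) k^-1 ^+ 2 * #|T|%:R + k^-1 * #|T|%:R))).
  apply: ler_sum => x xS.
  rewrite (bigD1 x) //= addrC; apply: lerD; last first.
    rewrite (eq_bigr (fun f : T => (f (blk x) == pos x)%:R)) ?sum_hit //.
    by move=> f _; case: eqP; rewrite ?mulr1 ?mulr0.
  rewrite [leRHS](bigD1 x) //= ler_wpDl //.
    by rewrite mulr_ge0 ?ler0n // exprn_ge0 // invr_ge0.
  apply: ler_sum => y /andP[yS yx].
  have [bxy|bxy] := eqVneq (blk x) (blk y); last by rewrite sum_hit2.
  (* Two distinct points of one block have distinct positions, so they are never hit together. *)
  rewrite big1 ?mulr_ge0 ?exprn_ge0 ?invr_ge0 // => f _.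
  rewrite bxy; have [/eqP fx|] := eqVneq (f (blk y)) (pos x);
    last by rewrite mul0r.
  have [fy|] := eqVneq (f (blk y)) (pos y); last by rewrite mulr0.
  case/eqP: yx; apply: inj => //=; congr (_, _) => //.
  by rewrite -fy (eqP fx).
have sumS (c : R) : \sum_(x in S) c = #|S|%:R * c
  by rewrite sumr_const mulr_natl.
by rewrite !sumS le_eqVlt; apply/orP; left; apply/eqP; ring.
Qed.

End RandomFunction.

(** * The protocol for a given sampling rule [S] and degree cap [D] *)

Section SamplingProtocol.
Variables (n P l N D : nat) (c : 'I_n * 'I_n -> l.-tuple bool).
Variable S : N.-tuple bool -> {set 'I_n}.
Hypotheses (l_gt0 : (0 < l)%N) (c_inj : injective c).

Definition decode (m : seq bool) : {set 'I_n * 'I_n} :=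
  odflt set0 [pick E | encode c E == m].

Lemma encodeK : cancel (encode c) decode.
Proof.
move=> E; rewrite /decode; case: pickP => [F /eqP/(encode_inj l_gt0 c_inj) //|].
by move/(_ E); rewrite eqxx.
Qed.

Definition sampling_protocol : sim_protocol n P :=
  @SimProtocol n P N
    (fun _ H w => encode c (sent_edges D (S w) (edges H)))
    (fun ms => max_matching (\bigcup_p decode (ms p))).

Variables (G : bigraph 'I_n) (Gs : 'I_P -> bigraph 'I_n).
Hypothesis GGs : edge_disjoint_union G Gs.

Let received (w : N.-tuple bool) : {set 'I_n * 'I_n} :=
  \bigcup_p sent_edges D (S w) (edges (Gs p)).

Lemma run_sampling w :
  @run n P sampling_protocol Gs w = max_matching (received w).
Proof.
rewrite /run /=; congr max_matching.
by apply: eq_bigr => p _; rewrite ffunE encodeK.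
Qed.

Lemma received_sub w : received w \subset edges G.
Proof.
apply/bigcupsP => p _; apply: subset_trans (sent_edges_sub _ _ _) _.
by case: GGs => /(_ p)[].
Qed.

Lemma edge_party e : e \in edges G -> exists p, e \in edges (Gs p).
Proof. by case: GGs => _ _ _ _ <- /bigcupP[p _ ep]; exists p. Qed.

Lemma run_is_matching w : is_matching G (@run n P sampling_protocol Gs w).
Proof.
rewrite run_sampling; apply/andP; split; last exact: max_matching_set.
exact: subset_trans (max_matching_sub _) (received_sub w).
Qed.

Lemma run_gt0 w : matching_number G != 0%N ->
  (0 < #|@run n P sampling_protocol Gs w|)%N.
Proof.
have [M /andP[sM _] <-] := matching_number_witness G.
rewrite cards_eq0 => /set0Pn[e /(subsetP sM) /edge_party[p ep]].
rewrite run_sampling; apply: max_matching_gt0.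
have : sent_edges D (S w) (edges (Gs p)) != set0.
  by apply: sent_edges_neq0; apply/set0Pn; exists e.
by case/set0Pn => f fS; apply/set0Pn; exists f; apply/bigcupP; exists p.
Qed.

Lemma run_full w : S w = [set: 'I_n] -> (n <= D)%N ->
  (matching_number G <= #|@run n P sampling_protocol Gs w|)%N.
Proof.
move=> Sw nD; have [M /andP[sM mM] <-] := matching_number_witness G.
rewrite run_sampling; apply: max_matching_max mM.
apply: (subset_trans sM); apply/subsetP => e /edge_party[p ep].
by apply/bigcupP; exists p => //; rewrite sent_edges_full ?card_ord.
Qed.

(** An edge of [M] not received was omitted by the party holding it, and that party alone already
    supplies [D] neighbours of its left endpoint. *)
Lemma run_sampled w M : is_matching G M -> (#|S w| <= D)%N ->
  (#|(fst @: M) :&: S w| <= 2 * #|@run n P sampling_protocol Gs w|)%N.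
Proof.
move=> /andP[sM mM] cS; rewrite run_sampling.
apply: max_matching_sampled cS _ => // e eM eS eN.
have [p ep] := edge_party (subsetP sM _ eM).
have sp : sent_edges D (S w) (edges (Gs p)) \subset received w.
  exact: (bigcup_sup p).
apply: leq_trans (sent_edges_degree ep eS _) _.
  by apply: contra eN; apply: (subsetP sp).
apply/subset_leq_card/subsetP => y; rewrite inE => yS.
by rewrite inE; apply: (subsetP sp).
Qed.

Lemma size_message p w : (#|S w| <= D)%N ->
  (size (@message n P sampling_protocol p (Gs p) w) <= (D * D + 1) * l)%N.
Proof.
move=> cS; rewrite /= size_encode leq_mul2r; apply/orP; right.
apply: leq_trans (card_sent_edges _ _ _) _.
by rewrite leq_add2r leq_mul2r cS orbT.
Qed.

End SamplingProtocol.

(** * From extended-real factors to real bounds *)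

Section ExpectedFactor.
Variable R : realType.

Lemma expected_factor_le (n P : nat) (prot : sim_protocol n P)
    (G : bigraph 'I_n) (Gs : 'I_P -> bigraph 'I_n)
    (g : (ncoins prot).-tuple bool -> R) (z : R) :
  (forall w, (approx_factor R G (run Gs w) <= (g w)%:E)%E) ->
  \sum_w g w <= z * 2 ^+ ncoins prot ->
  (expected_factor R prot G Gs <= z%:E)%E.
Proof.
move=> le_g sum_g; rewrite /expected_factor.
have e0 : 0 < 2 ^+ ncoins prot :> R by rewrite exprn_gt0.
apply: (@le_trans _ _ (((2 ^+ ncoins prot)^-1)%:E * (\sum_w g w)%:E)%E).
  apply: lee_wpmul2l; first by rewrite lee_fin invr_ge0 ltW.
  by rewrite -sumEFin; apply: lee_sum => w _; apply: le_g.
by rewrite -EFinM lee_fin ler_pdivrMl // mulrC.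
Qed.

Lemma approx_factor_le1 (V : finType) (G : bigraph V) (N : {set V * V}) :
  (matching_number G <= #|N|)%N -> (approx_factor R G N <= 1)%E.
Proof.
move=> leN; rewrite /approx_factor; case: eqP => // /eqP; rewrite -lt0n => m0.
have N0 : (0 < #|N|)%N by apply: leq_trans leN.
by rewrite (gtn_eqF N0) lee_fin ler_pdivrMr ?ltr0n // mul1r ler_nat.
Qed.

(** The constant comes from [1 + x <= 1 + 2 * #|N| <= 3 * #|N|]. *)
Lemma approx_factor_sampled (V : finType) (G : bigraph V) (N : {set V * V})
    (x : nat) :
  matching_number G != 0%N -> (0 < #|N|)%N -> (x <= 2 * #|N|)%N ->
  (approx_factor R G N <=
     (3 * (matching_number G)%:R * (1 + x%:R)^-1)%:E)%E.
Proof.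
move=> m0 N0 xN; rewrite /approx_factor (negPf m0) gtn_eqF // lee_fin.
rewrite [3 * _]mulrC -mulrA ler_wpM2l ?ler0n //.
have N1 : 1 <= #|N|%:R :> R by rewrite ler1n.
have x0 : 0 <= x%:R :> R by rewrite ler0n.
have xN' : x%:R <= 2 * #|N|%:R :> R by rewrite -natrM ler_nat.
rewrite ler_pdivlMr; last by lra.
rewrite mulrC ler_pdivrMr; lra.
Qed.

End ExpectedFactor.

Lemma leq_card_injection (T U : finType) :
  (#|T| <= #|U|)%N -> exists f : T -> U, injective f.
Proof.
move=> le; exists (fun x => enum_val (widen_ord le (enum_rank x))) => x y.
by move/enum_val_inj/(congr1 val) => /= /val_inj/enum_rank_inj.
Qed.

(** * Cutting the vertices into blocks and sampling with fair bits *)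

Section BlockSampling.
Variables (n t : nat).
Let K := (2 ^ t)%N.
Let B := (n %/ K).+1.

Let K_gt0 : (0 < K)%N. Proof. by rewrite expn_gt0. Qed.

(** [inord] never takes its default value here, because [v %/ K <= n %/ K < B]. *)
Definition block (v : 'I_n) : 'I_B := inord (v %/ K).
Definition position (v : 'I_n) : 'I_K := Ordinal (ltn_pmod v K_gt0).

Lemma block_position_inj : injective (fun v => (block v, position v)).
Proof.
move=> x y [/(congr1 val) /= bxy pxy]; apply: val_inj => /=.
rewrite (divn_eq x K) (divn_eq y K) pxy.
by move: bxy; rewrite !inordK ?ltnS ?leq_div2r // 1?ltnW // => ->.
Qed.

Definition sampled (f : {ffun 'I_B -> 'I_K}) : {set 'I_n} :=
  [set v | f (block v) == position v].

Lemma card_sampled f : (#|sampled f| <= B)%N.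
Proof.
rewrite -[B in (_ <= B)%N]card_ord.
rewrite -(@card_in_imset _ _ block); first exact: max_card.
move=> x y; rewrite !inE => /eqP fx /eqP fy bxy.
by apply: block_position_inj; rewrite /= bxy -fx -fy bxy.
Qed.

Lemma sampled_full f : t = 0%N -> sampled f = [set: 'I_n].
Proof.
move=> t0; apply/setP => v; rewrite !inE; apply/eqP/val_inj => /=.
have K1 : K = 1%N by rewrite /K t0.
by case: (f _) => i /= hi; move: hi; rewrite K1 modn1; case: i.
Qed.

(** As [K] is a power of two, [t] bits per block give an exactly uniform function. *)
Lemma coins_to_function :
  exists phi : (t * B).-tuple bool -> {ffun 'I_B -> 'I_K}, bijective phi.
Proof.
have e : #|{: (t * B).-tuple bool}| = #|{ffun 'I_B -> 'I_K}|.
  by rewrite card_tuple card_bool card_ffun !card_ord expnM.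
have [|phi phi_inj] := @leq_card_injection {: (t * B).-tuple bool}
  {ffun 'I_B -> 'I_K}.
  by rewrite e.
by exists phi; apply: inj_card_bij => //; rewrite e.
Qed.

End BlockSampling.

Lemma edge_code (n l : nat) : (n <= 2 ^ l)%N ->
  exists c : 'I_n * 'I_n -> (l.*2).-tuple bool, injective c.
Proof.
move=> le; apply: leq_card_injection.
rewrite card_prod card_tuple card_bool !card_ord -addnn expnD.
exact: leq_mul.
Qed.

(** * Choice of the block size and the resulting message length *)

Section BlockExponent.
Variable R : realType.

(** This is [ln (1 + y) <= y] at [y = - 1 / 2]. *)
Lemma ln2_ge_half : 1 / 2 <= ln 2 :> R.
Proof.
have lt1 : -1 < - (1 / 2) :> R by lra.
have := le_ln1Dx lt1; have -> : 1 + - (1 / 2) = 2^-1 :> R by field.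
by rewrite lnV ?posrE //; lra.
Qed.

Lemma trunc_log_le_ln (n : nat) : (0 < n)%N ->
  (trunc_log 2 n)%:R <= 2 * ln n%:R :> R.
Proof.
move=> n0; have /andP[le _] := trunc_log_bounds (isT : (1 < 2)%N) n0.
have : ln (2 ^+ trunc_log 2 n) <= ln n%:R :> R.
  by rewrite ler_ln ?posrE ?exprn_gt0 ?ltr0n // -natrX ler_nat.
rewrite lnXn // -[_ *+ trunc_log 2 n]mulr_natr; have := ln2_ge_half.
have : 0 <= (trunc_log 2 n)%:R :> R by rewrite ler0n.
move: (trunc_log 2 n)%:R (ln 2) (ln n%:R) => a b c; nra.
Qed.

Lemma block_exponent (n : nat) (x : R) : (0 < n)%N -> 1 <= x -> x <= n%:R ->
  exists t, [/\ (2 ^ t <= n)%N, x <= 12 * (2 ^ t)%:R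
              & t != 0%N -> 6 * (2 ^ t)%:R <= x].
Proof.
move=> n0 x1 xn; have [x6|x6] := ltP x 6.
  by exists 0%N; split=> //; lra.
have y0 : 0 <= x / 6 by rewrite divr_ge0 //; lra.
have /andP[le1 lt1] := Num.Theory.truncn_itv y0.
(* Rounding [x / 6] down to an integer and then to a power of two gives [2 ^ t <= x / 6 < 2 ^ t.+1],
   hence the constants 6 and 12. *)
set k := Num.truncn (x / 6) in le1 lt1.
have k0 : (0 < k)%N.
  rewrite lt0n; apply/eqP => k0; move: lt1; rewrite k0 ltr_pdivrMr; lra.
have /andP[le2 lt2] := trunc_log_bounds (isT : (1 < 2)%N) k0.
set t := trunc_log 2 k in le2 lt2.
have le3 : (2 ^ t)%:R <= k%:R :> R by rewrite ler_nat.
have le4 : k.+1%:R <= 2 * (2 ^ t)%:R :> R by rewrite -natrM ler_nat -expnS.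
have xE : x = 6 * (x / 6) by field.
exists t; split=> [||_]; last 2 first; try by lra.
by rewrite -(ler_nat R); lra.
Qed.

End BlockExponent.

(** With [b] the power of [n] on the right, [K * B <= 2 * n] and [n ^ alpha <= 12 * K] give
    [B ^ 2 <= 24 ^ 2 * b = 576 * b]. Then [B ^ 2 + 1 <= 1152 * b], and a code word has at most
    [4 * (1 + ln n)] bits; the product gives 4608. *)
Lemma message_size_bound (R : realType) (n t : nat) (alpha : R) :
  (0 < n)%N -> (2 ^ t <= n)%N -> n%:R `^ alpha <= 12 * (2 ^ t)%:R ->
  (((n %/ 2 ^ t).+1 * (n %/ 2 ^ t).+1 + 1) * ((trunc_log 2 n).+1.*2))%:R
    <= 4608 * n%:R `^ (2 - 2 * alpha) * (1 + ln n%:R) ^+ 1.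
Proof.
move=> n0 leKn le12; set K := (2 ^ t)%N in leKn le12 *.
set B := (n %/ K).+1.
have K0 : 0 < K%:R :> R by rewrite ltr0n expn_gt0.
have n0R : 0 < n%:R :> R by rewrite ltr0n.
have KB : K%:R * B%:R <= 2 * n%:R :> R.
  rewrite -!natrM ler_nat mulnS mul2n -addnn leq_add // mulnC.
  exact: leq_trunc_div.
have B1 : 1 <= B%:R :> R by rewrite ler1n.
set a := n%:R `^ alpha in le12 *.
have a0 : 0 < a by rewrite powR_gt0.
set b := n%:R `^ (2 - 2 * alpha).
have ab : b * a ^+ 2 = n%:R ^+ 2.
  rewrite -powR_mulrn ?(ltW a0) // /a -powRrM -powRD; last first.
    by apply/implyP => _; rewrite gt_eqF.
  by rewrite mulrC -[X in _ = X]powR_mulrn ?(ltW n0R) //; congr (_ `^ _); ring.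
have b0 : 0 < b by rewrite powR_gt0.
have Bb : B%:R ^+ 2 <= 576 * b.
  have h1 : (K%:R * B%:R) ^+ 2 <= (2 * n%:R) ^+ 2 :> R.
    by rewrite ler_pXn2r ?nnegrE ?mulr_ge0 ?ler0n.
  have h2 : a ^+ 2 <= (12 * K%:R) ^+ 2.
    by rewrite ler_pXn2r ?nnegrE ?mulr_ge0 ?(ltW a0) ?ler0n.
  rewrite -(@ler_pM2l _ (K%:R ^+ 2)) ?exprn_gt0 // -exprMn.
  apply: (le_trans h1); rewrite exprMn -ab.
  apply: (@le_trans _ _ (2 ^+ 2 * (b * (12 * K%:R) ^+ 2))).
    by rewrite !ler_pM2l.
  by rewrite le_eqVlt; apply/orP; left; apply/eqP; ring.
have L := trunc_log_le_ln R n0.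
have L0 : 0 <= (trunc_log 2 n)%:R :> R by rewrite ler0n.
rewrite expr1 -muln2 !natrM natrD natrM -[_.+1%:R]natr1.
set x := (trunc_log 2 n)%:R in L L0 *.
have -> : 4608 * b * (1 + ln n%:R) = (1152 * b) * (4 * (1 + ln n%:R)) by ring.
by apply: ler_pM; nra.
Qed.

(** * Assembly of the protocol and its guarantees *)

Theorem theorem3 (R : realType) :
  exists (C : R) (c : nat), forall (n P : nat) (alpha : R),
    (1 <= n)%N -> (1 <= P)%N -> 0 <= alpha <= 1 ->
    exists prot : sim_protocol n P,
      forall (G : bigraph 'I_n) (Gs : 'I_P -> bigraph 'I_n),
        vertices G = [set: 'I_n] -> edge_disjoint_union G Gs ->
        [/\ forall w : (ncoins prot).-tuple bool,
              is_matching G (run Gs w),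
            (expected_factor R prot G Gs <= (n%:R `^ alpha)%:E)%E
          & forall (p : 'I_P) (w : (ncoins prot).-tuple bool),
              (size (message p (Gs p) w))%:R
                <= C * n%:R `^ (2 - 2 * alpha) * (1 + ln n%:R) ^+ c].
Proof.
exists 4608, 1%N => n P alpha n0 _ /andP[alpha0 alpha1].
have n1 : 1 <= n%:R :> R by rewrite ler1n.
have x1 : 1 <= n%:R `^ alpha by rewrite -[leLHS](powRr0 n%:R) ler_powR.
have xn : n%:R `^ alpha <= n%:R.
  by rewrite -[leRHS]powRr1 ?ler0n // ler_powR.
have [t [leKn le12 ge6]] := block_exponent n0 x1 xn.
have [phi phi_bij] := coins_to_function n t.
have le2 : (n <= 2 ^ (trunc_log 2 n).+1)%N.
  by apply: ltnW; case/andP: (trunc_log_bounds (isT : (1 < 2)%N) n0).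
have [c c_inj] := edge_code le2.
pose S w := sampled (phi w).
pose D := (n %/ 2 ^ t).+1.
have cS w : (#|S w| <= D)%N by apply: card_sampled.
have l0 : (0 < (trunc_log 2 n).+1.*2)%N by rewrite double_gt0.
exists (sampling_protocol P D c S) => G Gs _ GGs; split.
- by move=> w; apply: run_is_matching.
- have card_coins : #|{: (t * D).-tuple bool}|%:R = 2 ^+ (t * D) :> R.
    by rewrite card_tuple card_bool natrX.
  have [m0|m0] := eqVneq (matching_number G) 0%N.
    apply: (@expected_factor_le _ _ _ _ _ _ (fun=> 1)).
      by move=> w; apply: approx_factor_le1; rewrite m0.
    by rewrite sumr_const card_coins ler_peMl // exprn_ge0.
  (* Blocks are singletons: every vertex is selected and [D = n + 1] exceeds every degree, so the
     whole graph is sent. *)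
  have [t0|t0] := eqVneq t 0%N.
    apply: (@expected_factor_le _ _ _ _ _ _ (fun=> 1)).
      move=> w; apply: approx_factor_le1; apply: run_full => //.
        exact: sampled_full.
      by rewrite /D t0 divn1.
    by rewrite sumr_const card_coins ler_peMl // exprn_ge0.
  have [M mM cM] := matching_number_witness G.
  have cM' : #|fst @: M| = matching_number G.
    by rewrite card_in_imset //; case/andP: mM => _ /matching_fst_inj.
  apply: (@expected_factor_le _ _ _ (sampling_protocol P D c S) G Gs
    (fun w => 3 * (matching_number G)%:R * (1 + #|(fst @: M) :&: S w|%:R)^-1)).
    move=> w; apply: approx_factor_sampled => //;
      first exact: (run_gt0 l0 c_inj GGs).
    exact: (run_sampled l0 c_inj GGs).
  rewrite -mulr_sumr.
  have [psi phiK psiK] := phi_bij.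
  (* The average over coin strings becomes one over functions, where the hit bound applies. *)
  rewrite (reindex psi) /=; last by apply: onW_bij; exists phi.
  have K_gt0 : (0 < 2 ^ t)%N by rewrite expn_gt0.
  have inj : {in fst @: M &, injective (fun v => (block t v, position t v))}.
    exact: in2W (@block_position_inj n t).
  have := sum_inv_hits R K_gt0 inj.
  rewrite cM' -(bij_eq_card phi_bij) card_coins => hits.
  have eqX (f : {ffun 'I_D -> 'I_(2 ^ t)}) :
    [set x in fst @: M | f (block t x) == position t x]
      = (fst @: M) :&: S (psi f) by apply/setP => x; rewrite !inE psiK.
  under eq_bigr do rewrite -eqX.
  apply: le_trans (ler_wpM2l _ hits) _; first by rewrite mulr_ge0.
  rewrite mulrA ler_wpM2r ?exprn_ge0 //; apply: le_trans (ge6 t0).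
  set K := (2 ^ t)%:R; set m := (matching_number G)%:R.
  have K0 : 0 < K :> R by rewrite ltr0n expn_gt0.
  have m0' : 0 <= m :> R by rewrite ler0n.
  have u0 : 0 < 1 + m / K by rewrite ltr_pwDl // divr_ge0 // ltW.
  (* It remains to see that [3 * m * 2 <= 6 * K * (1 + m / K)], whose right side is
     [6 * K + 6 * m]. *)
  rewrite mulrA ler_pdivrMr //.
  have -> : 6 * K * (1 + m / K) = 6 * K + 6 * m by field; rewrite gt_eqF.
  by lra.
- move=> p w; apply: le_trans (message_size_bound n0 leKn le12).
  by rewrite ler_nat; apply: size_message.
Qed.
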